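(* For every integer $n\ge 1$, the $n$-dimensional hypercube $Q_n$ satisfies $S(Q_n)=2n-1$.
   Context: For a finite simple graph $G=(V,E)$ and an injective map $f:V\to\mathbb Z$, let $\sigma(G,f)=\{f(v)+f(w): vw\in E\}$. The sum index of $G$ is $S(G)=\min_{f}|\sigma(G,f)|$ over all injective $f:V\to\mathbb Z$. $Q_1$ is the graph with two vertices joined by an edge, and $Q_n=Q_{n-1}\,\square\, P_2$ is obtained by taking two copies of $Q_{n-1}$ and joining each vertex to its copy. *)

(* Defs.v *)
From HB Require Import structures.
From mathcomp Require Import all_boot all_order all_algebra.
From mathcomp Require Import boolp.

Set Implicit Arguments.
Unset Strict Implicit.
Unset Printing Implicit Defensive.

Import Order.TTheory GRing.Theory Num.Theory.

Record sgraph := SGraph {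
  vertex :> finType;
  adj : rel vertex;
  adj_sym : symmetric adj;
  adj_irrefl : irreflexive adj }.

Section Sum.
Variable G : sgraph.

Definition edge_sums (f : G -> int) : seq int :=
  undup [seq (f e.1 + f e.2)%R | e <- enum {: G * G} & adj e.1 e.2].

Definition sum_count (k : nat) : bool :=
  `[< exists2 f : G -> int, injective f & size (edge_sums f) = k >].

Lemma sum_count_ex : exists k, sum_count k.
Proof.
pose f (v : G) : int := Posz (enum_rank v).
exists (size (edge_sums f)); apply/asboolP; exists f => //.
by move=> u v [/val_inj /enum_rank_inj].
Qed.

Definition sum_index : nat := ex_minn sum_count_ex.

End Sum.

Section Path.
Variable m : nat.

Definition path_adj : rel 'I_m := [rel i j : 'I_m | (i.+1 == j) || (j.+1 == i)].

Lemma path_adj_sym : symmetric path_adj.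
Proof. by move=> i j; rewrite /path_adj /= orbC. Qed.

Lemma path_adj_irrefl : irreflexive path_adj.
Proof. by move=> i; rewrite /path_adj /= orbb gtn_eqF. Qed.

Definition path_graph : sgraph := SGraph path_adj_sym path_adj_irrefl.

End Path.

Section Box.
Variables G H : sgraph.

Definition box_adj : rel (G * H)%type :=
  [rel x y : G * H | (x.1 == y.1) && adj x.2 y.2 || adj x.1 y.1 && (x.2 == y.2)].

Lemma box_adj_sym : symmetric box_adj.
Proof.
by move=> x y; rewrite /box_adj /= (adj_sym x.1) (adj_sym x.2) !(eq_sym y.1, eq_sym y.2).
Qed.

Lemma box_adj_irrefl : irreflexive box_adj.
Proof. by move=> x; rewrite /box_adj /= !adj_irrefl andbF. Qed.

Definition box : sgraph := SGraph box_adj_sym box_adj_irrefl.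

End Box.

(* The value at 0 is only a convention (a single vertex). *)
Fixpoint hypercube (n : nat) : sgraph :=
  match n with
  | 0 => path_graph 1
  | 1 => path_graph 2
  | n'.+1 => box (hypercube n') (path_graph 2)
  end.

(* Main.v *)
(** Lower bound: at a vertex [u] of largest label and a vertex [v] of smallest
label, the sums over the edges at [u] and over the edges at [v] give at least
[n] values each, and a common value [f u + f w = f v + f w'] forces
[f w' - f w = f u - f v], hence [w = v] and [w' = u].

Upper bound: label a vertex [x] by [g x] or [- (g x + 1)] according to the
parity of its weight, where [g x] is the number written by all the bits of [x]
but one.  Two neighbours have opposite parities, so every edge sum is [-1 + d]
with [d] zero or plus or minus one of [n - 1] powers of two; two vertices that
share the value of [g] have labels of opposite signs. *)
Require Import Defs.
From mathcomp Require Import all_boot all_order all_algebra.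
From mathcomp Require Import boolp zify.

Set Implicit Arguments.
Unset Strict Implicit.
Unset Printing Implicit Defensive.

Import Order.TTheory GRing.Theory Num.Theory.

Lemma mem_edge_sums (G : sgraph) (f : G -> int) (s : int) :
  reflect (exists x y, adj x y /\ s = (f x + f y)%R) (s \in edge_sums f).
Proof.
rewrite mem_undup; apply: (iffP mapP) => [[[x y]]|[x [y [xy ->]]]].
  by rewrite mem_filter /= => /andP[xy _] ->; exists x, y.
by exists (x, y) => //; rewrite mem_filter /= xy mem_enum.
Qed.

Lemma edge_sums_degree (G : sgraph) (f : G -> int) (d : nat) (x0 : G) :
  injective f -> (forall x : G, d <= #|adj x|) ->
  2 * d - 1 <= size (edge_sums f).
Proof.
move=> f_inj deg.
have [u _ umax] := @arg_maxP _ _ G x0 predT f isT.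
have [v _ vmin] := @arg_minP _ _ G x0 predT f isT.
pose S x := [seq (f x + f w)%R | w <- enum (adj x)].
have uniqS x : uniq (S x).
  by rewrite map_inj_uniq ?enum_uniq // => w w' /addrI /f_inj.
have sizeS x : size (S x) = #|adj x| by rewrite size_map cardE.
have subS x : {subset S x <= edge_sums f}.
  by move=> s /mapP[w]; rewrite mem_enum => xw ->; apply/mem_edge_sums; exists x, w.
(* Only [f u + f v] can occur in both lists. It occurs at most once in [S v], so removing it costs
   one value: hence the [- 1]. *)
pose T := S u ++ filter (predC1 (f u + f v)%R) (S v).
have uniqT : uniq T.
  rewrite cat_uniq uniqS filter_uniq // andbT /=; apply/hasPn => s.
  rewrite mem_filter => /andP[/= ns /mapP[w' _ sE]].
  apply/negP => /mapP[w _ sE']; case/eqP: ns; rewrite sE'.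
  have := umax w' isT; have := vmin w isT; lia.
have subT : {subset T <= edge_sums f}.
  move=> s; rewrite mem_cat mem_filter => /orP[|/andP[_]]; exact: subS.
apply: leq_trans (uniq_leq_size uniqT subT); rewrite size_cat size_filter.
have := count_predC (pred1 (f u + f v)%R) (S v).
rewrite (count_uniq_mem _ (uniqS v)) !sizeS => vE.
have := leq_b1 ((f u + f v)%R \in S v); move: (deg u) (deg v); rewrite -vE.
move: (nat_of_bool _) (count _ _) #|adj u| => i j k; lia.
Qed.

Lemma box_degree (G H : sgraph) (x : G) (y : H) :
  #|adj x| + #|adj y| <= #|@adj (box G H) (x, y)|.
Proof.
have injl : injective (fun z : G => (z, y)) by move=> ? ? [].
have injr : injective (fun z : H => (x, z)) by move=> ? ? [].
pose A := [set (z, y) | z in adj x]; pose B := [set (x, z) | z in adj y].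
have dAB : [disjoint A & B].
  (* A common element would be [(x, y)] itself, making [x] adjacent to itself. *)
  apply/pred0P => p; apply/negP => /andP[/imsetP[z xz ->] /imsetP[w _ []]] zx.
  by move: xz; rewrite zx -topredE /= adj_irrefl.
have := leq_card_setU A B.
rewrite dAB /A /B !card_imset // => /leqifP /eqP /=.
move=> <-; apply/subset_leq_card/subsetP => p /setUP[] /imsetP[z];
  by rewrite -topredE /= => zN ->; rewrite unfold_in /= eqxx zN ?orbT.
Qed.

Lemma path2_degree (i : path_graph 2) : 1 <= #|adj i|.
Proof.
apply/card_gt0P; exists (rev_ord i).
by case: i => [[|[|]]].
Qed.

Lemma hypercube_degree n (x : hypercube n) : n <= #|adj x|.
Proof.
case: n x => [//|n]; elim: n => [|n IH]; first exact: path2_degree.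
case=> x i; apply: leq_trans (box_degree x i).
by rewrite -addn1 leq_add // path2_degree.
Qed.

(** These are 0 and plus or minus 2^i for i < n, the changes made to a number by flipping at most
    one of [n] bits. The 0 serves the edges in the direction that [g] ignores. *)
Fixpoint bit_diffs (n : nat) : seq int :=
  if n is n'.+1 then [:: 1, -1 & [seq 2 * d | d <- bit_diffs n']]%R
  else [:: 0%R].

Lemma size_bit_diffs n : size (bit_diffs n) = (2 * n).+1.
Proof. by elim: n => //= n IH; rewrite size_map IH; lia. Qed.

Lemma hypercube_parity_bits n :
  exists (p : hypercube n.+1 -> bool) (g : hypercube n.+1 -> nat),
    [/\ forall x y, p x = p y -> g x = g y -> x = y,
        forall x y, adj x y -> p y = ~~ p x &
        forall x y, adj x y -> ((g x)%:Z - (g y)%:Z)%R \in bit_diffs n].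
Proof.
have ord2 (i j : 'I_2) : odd i = odd j -> i = j.
  by case: i j => [[|[|]]] // ? [[|[|]]] // ? _; apply: val_inj.
have adj2 (i j : path_graph 2) : adj i j -> odd j = ~~ odd i.
  by case: i j => [[|[|]]] // ? [[|[|]]].
elim: n => [|n [p [g [pg_inj p_adj g_adj]]]].
  (* The first coordinate is the bit that [g] omits; the parity [p] recovers it from the other
     bits. *)
  exists (fun i : 'I_2 => odd i), (fun=> 0); split=> // x y.
  by move/ord2.
exists (fun x : hypercube n.+1 * 'I_2 => p x.1 (+) odd x.2).
(* The new coordinate enters as the lowest bit: the old differences double, as in [bit_diffs], and
   the bit can be read off modulo 2. *)
exists (fun x : hypercube n.+1 * 'I_2 => 2 * g x.1 + odd x.2); split.
- move=> [x i] [y j] /= pE gE.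
  have ij : odd i = odd j by move: gE; case: (odd i); case: (odd j); lia.
  by congr pair; [apply: pg_inj; [move: pE; rewrite ij => /addIb|lia]|exact: ord2].
- move=> [x i] [y j] /= /orP[]/andP[] /= => [/eqP <- /adj2 ->|/p_adj -> /eqP <-].
    by rewrite addbN.
  by rewrite addNb.
- move=> [x i] [y j] /= /orP[]/andP[] /= => [/eqP <- /adj2 ->|/g_adj xy /eqP <-].
    rewrite !inE; case: (odd i) => /=; apply/orP; [left|right; apply/orP; left];
    apply/eqP; lia.
  rewrite !inE; apply/orP; right; apply/orP; right; apply/mapP.
  by exists ((g x)%:Z - (g y)%:Z)%R => //; lia.
Qed.

Lemma hypercube_labelling n :
  exists2 f : hypercube n.+1 -> int, injective f & size (edge_sums f) <= (2 * n).+1.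
Proof.
have [p [g [pg_inj p_adj g_adj]]] := hypercube_parity_bits n.
exists (fun x => if p x then (- (g x).+1%:Z)%R else Posz (g x)).
  move=> x y; case px: (p x); case py: (p y) => E; try lia;
    by apply: pg_inj; [rewrite px py|lia].
(* The ends of an edge have labels of opposite signs, so the edge sum is a difference of two values
   of [g], minus 1. *)
rewrite -size_bit_diffs -(size_map (fun d => d - 1)%R (bit_diffs n)).
apply: uniq_leq_size; first exact: undup_uniq.
move=> s /mem_edge_sums[x [y [xy ->]]]; apply/mapP; rewrite (p_adj _ _ xy).
case: (p x) => /=.
  by exists ((g y)%:Z - (g x)%:Z)%R; [apply: g_adj; rewrite adj_sym|lia].
by exists ((g x)%:Z - (g y)%:Z)%R; [exact: g_adj|lia].
Qed.

(** Supplies the vertex [x0] from which [edge_sums_degree] picks its extremal labels. *)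
Lemma hypercube_inhabited n : hypercube n.
Proof. by case: n => [|n]; [|elim: n => [|n x]; [|split=> //]]; exact: ord0. Qed.

Theorem theorem2p4 (n : nat) (hn : 1 <= n) :
  sum_index (hypercube n) = 2 * n - 1.
Proof.
case: n hn => // n _; rewrite /sum_index; case: ex_minnP => k.
move=> /asboolP[f f_inj <-] kmin; apply/eqP; rewrite eqn_leq.
rewrite (edge_sums_degree (hypercube_inhabited _) f_inj (@hypercube_degree _)).
have [h h_inj h_size] := hypercube_labelling n.
have := kmin (size (edge_sums h)); rewrite andbT => /(_ _)/leq_trans; apply.
  by apply/asboolP; exists h.
by move: h_size; lia.
Qed.
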